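(* $\Phi(42)<\gamma_{42}$, where $\gamma_n$ denotes the maximum possible size of a tiling Condorcet domain in $\mathcal L([n])$ and $\Phi(n)$ denotes the cardinality of Fishburn's domain in $\mathcal L([n])$. That is, there is a rhombus tiling $T$ of the zonogon $Z_{42}$ with $|\Sigma(T)|>\Phi(42)$.
   Context: Linear orders. $[n]=\{1,\dots,n\}$, and $\mathcal L([n])$ is the set of linear orders on $[n]$. A linear order $x_1<\dots<x_n$ is encoded by the word $x_1\dots x_n$ ($x_1$ least/worst, $x_n$ greatest/best). Fishburn's domain. It is the set of all linear orders $\sigma\in\mathcal L([n])$ such that for each triple $i<j<k$ in $[n]$: if $j$ is even, then $j$ is not the least of $i,j,k$ with respect to $\sigma$ (peak condition); if $j$ is odd, then $j$ is not the greatest of $i,j,k$ with respect to $\sigma$ (pit condition). Its cardinality is $\Phi(n)$. Tiling Condorcet domains. In the upper half-plane $\mathbb R\times\mathbb R_{>0}$ fix $n$ vectors $\xi_1,\dots,\xi_n$ of the same length and with distinct directions, going in this order clockwise around $(0,0)$. The zonogon is $Z_n=\{\sum_i a_i\xi_i: 0\le a_i\le 1\}$; its bottom vertex is $(0,0)$ and its top vertex is $\xi_1+\dots+\xi_n$. For $i<j$, an $ij$-tile is a translate of the rhombus $[0,\xi_i]+[0,\xi_j]$. A rhombus tiling $T$ of $Z_n$ is a subdivision of $Z_n$ into such tiles in which any two intersecting tiles meet in a single vertex or a single closed edge. $G_T$ is the planar directed graph formed by the vertices and edges of the tiles, with edges directed upward; an edge that is a translate of $[0,\xi_i]$ has color $i$.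 A snake of $T$ is a directed path in $G_T$ from the bottom vertex to the top vertex. It is known that each snake has exactly $n$ edges, one of each color, so the sequence of colors along it (from bottom to top) is a linear order on $[n]$, the first color being the least element. $\Sigma(T)$ is the set of all linear orders obtained in this way. A tiling Condorcet domain is a set of the form $\Sigma(T)$. *)

(* Defs.v *)
From HB Require Import structures.
From mathcomp Require Import all_boot all_order all_algebra finmap.
From mathcomp Require Import boolp classical_sets reals.

Set Implicit Arguments.
Unset Strict Implicit.
Unset Printing Implicit Defensive.

Import Order.TTheory GRing.Theory Num.Theory.
Local Open Scope classical_set_scope.
Local Open Scope ring_scope.

(* The ground set [n] = {1, ..., n} is 'I_n: the ordinal i stands for the     *)
(* label i + 1. A linear order is encoded by its word, listed from the least  *)
(* element to the greatest one; a word of length n over 'I_n without          *)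
(* repetition contains every element.                                         *)
Record linord (n : nat) := LinOrd { word : n.-tuple 'I_n; _ : uniq word }.

HB.instance Definition _ (n : nat) := [isSub for @word n].
HB.instance Definition _ (n : nat) := [Finite of linord n by <:].

Definition label (n : nat) (i : 'I_n) : nat := i.+1.

Definition ord_lt (n : nat) (s : linord n) (a b : 'I_n) : bool :=
  (index a (word s) < index b (word s))%N.

Definition fishburn (n : nat) : {set linord n} :=
  [set s : linord n |
    [forall i : 'I_n, forall j : 'I_n, forall k : 'I_n,
      (i < j < k)%N ==>
        if odd (label j)
        then ~~ (ord_lt s i j && ord_lt s k j)
        else ~~ (ord_lt s j i && ord_lt s j k)]]%SET.

Definition Phi (n : nat) : nat := #|fishburn n|.

Section Tilings.
Variables (R : realType) (n : nat).
Implicit Types (u v : 'rV[R]_2) (xi : 'I_n -> 'rV[R]_2).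

Definition xcoord v : R := v ord0 ord0.
Definition ycoord v : R := v ord0 ord_max.
Definition len v : R := Num.sqrt (xcoord v ^+ 2 + ycoord v ^+ 2).

(* For u, v in the open upper half-plane, the direction of v is strictly      *)
(* clockwise from that of u iff det (u, v) < 0; in particular the third       *)
(* clause makes the directions distinct.                                      *)
Definition admissible xi : Prop :=
  [/\ forall i, 0 < ycoord (xi i),
      forall i j, len (xi i) = len (xi j) &
      forall i j : 'I_n, (i < j)%N ->
        xcoord (xi i) * ycoord (xi j) - ycoord (xi i) * xcoord (xi j) < 0].

Definition zonogon xi : set 'rV[R]_2 :=
  [set x | exists a : 'I_n -> R,
     (forall i, 0 <= a i <= 1) /\ x = \sum_i a i *: xi i].

Definition bottom_vertex : 'rV[R]_2 := 0.
Definition top_vertex xi : 'rV[R]_2 := \sum_i xi i.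

(* The edge (p, i) is the translate p + [0, xi_i]: it goes from p to p + xi_i *)
(* and has color i.                                                           *)
Definition edge : Type := ('rV[R]_2 * 'I_n)%type.
Definition edge_source (e : edge) : 'rV[R]_2 := e.1.
Definition edge_target xi (e : edge) : 'rV[R]_2 := e.1 + xi e.2.
Definition edge_color (e : edge) : 'I_n := e.2.
Definition edge_region xi (e : edge) : set 'rV[R]_2 :=
  [set x | exists a : R, 0 <= a <= 1 /\ x = e.1 + a *: xi e.2].

(* The tile (i, j, p) is the translate p + [0, xi_i] + [0, xi_j]; the         *)
(* condition i < j is part of is_tiling.                                      *)
Notation tile := ('I_n * 'I_n * 'rV[R]_2)%type.

Definition tile_region xi (t : tile) : set 'rV[R]_2 :=
  let: (i, j, p) := t in
  [set x | exists a b : R,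
     [/\ 0 <= a <= 1, 0 <= b <= 1 & x = p + a *: xi i + b *: xi j]].

Definition tile_vertices xi (t : tile) : seq 'rV[R]_2 :=
  let: (i, j, p) := t in [:: p; p + xi i; p + xi j; p + xi i + xi j].

Definition tile_edges xi (t : tile) : seq ('rV[R]_2 * 'I_n) :=
  let: (i, j, p) := t in [:: (p, i); (p, j); (p + xi i, j); (p + xi j, i)].

Definition meet_properly xi (t1 t2 : tile) : Prop :=
  let I := tile_region xi t1 `&` tile_region xi t2 in
  (exists v, [/\ v \in tile_vertices xi t1, v \in tile_vertices xi t2 &
                 I = [set v]]) \/
  (exists e, [/\ e \in tile_edges xi t1, e \in tile_edges xi t2 &
                 I = edge_region xi e]).

Definition is_tiling xi (T : {fset tile}) : Prop :=
  [/\ forall t, t \in T -> (t.1.1 < t.1.2)%N,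
      \bigcup_(t in [set t | t \in T]) tile_region xi t = zonogon xi &
      forall t1 t2, t1 \in T -> t2 \in T -> t1 != t2 ->
        tile_region xi t1 `&` tile_region xi t2 !=set0 ->
        meet_properly xi t1 t2].

Definition is_edge xi (T : {fset tile}) (e : edge) : Prop :=
  exists2 t, t \in T & e \in tile_edges xi t.

Fixpoint is_dipath xi (T : {fset tile}) u (s : seq edge) v : Prop :=
  if s is e :: s' then
    [/\ is_edge xi T e, edge_source e = u &
        is_dipath xi T (edge_target xi e) s' v]
  else u = v.

Definition is_snake xi (T : {fset tile}) (s : seq edge) : Prop :=
  is_dipath xi T bottom_vertex s (top_vertex xi).

Definition Sigma xi (T : {fset tile}) : {set linord n} :=
  [set w : linord n | `[< exists2 s : seq edge,
     is_snake xi T s & map edge_color s = word w >]]%SET.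

Definition tiling_domain xi (D : {set linord n}) : Prop :=
  exists2 T : {fset tile}, is_tiling xi T & D = Sigma xi T.

Definition gamma xi : nat :=
  (\max_(D : {set linord n} | `[< tiling_domain xi D >]) #|D|)%N.

Lemma ltn_gammaP xi (m : nat) :
  (m < gamma xi)%N <->
  exists2 T : {fset tile}, is_tiling xi T & (m < #|Sigma xi T|)%N.
Proof.
split=> [lt_m|[T tT lt_m]]; last first.
  apply: (leq_trans lt_m); rewrite /gamma.
  by apply: leq_bigmax_cond; apply/asboolP; exists T.
apply: contrapT => noT; move: lt_m; apply/negP; rewrite -leqNgt.
apply/bigmax_leqP => D /asboolP[T tT ->]; rewrite leqNgt.
by apply/negP => lt_m; apply: noT; exists T.
Qed.

End Tilings.

(* Main.v *)
From Stdlib Require Import NArith.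
Require Import Defs.
From mathcomp Require Import all_boot all_order all_algebra.
From mathcomp Require Import reals.
From mathcomp Require Import boolp classical_sets finmap ring lra zify.

(** The tiling with more snakes than Fishburn's domain is a concatenation of
    two copies of the Fishburn tiling with 21 colors. One of them, with colors
    1 to 21, sits at the bottom of the zonogon; the other one, with colors 22
    to 42, sits on top of it along the left boundary; the remaining region, to
    the right of both, is cut into a 21 by 21 grid of rhombi. Following a
    snake of the lower tiling and then one of the upper tiling gives
    Phi(21) ^ 2 = 19748211658816 snakes already, and Phi(42) is only
    19156227207750. Using the grid as well, there are 21358128049650 snakes
    that never follow the right boundary of the zonogon; these are the snakes
    that are counted here.

    Every tiling in play arises by sweeping a path over the zonogon, from the
    left boundary, with word 1 ... n, to the right boundary, with word
    n ... 1. Each step of a [sweep] exchanges two adjacent letters i < j, and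
    the path jumps over one rhombus. Paths are graphs of functions of the
    height ([path_at]), and a step increases this function exactly over the
    open height range of its rhombus. This gives the covering property
    ([sweep_cover]), because the two extreme paths enclose the zonogon
    ([path_at_convex], [path_at_concave]). It also controls intersections: if
    a later rhombus touches an earlier one at some height, then nothing
    happened to the path at this height in between, so that the vertex or edge
    of the path found there belongs to both rhombi ([rhombi_contact]). Two
    convex rhombi separated by a path and meeting only in this way meet in one
    common vertex or one common edge ([meet_ordered]). Hence every sweep gives
    a rhombus tiling ([sweep_is_tiling]).

    Both sides of the inequality then become counts of words read along a
    finite automaton whose states are the sets of letters already read. A
    Fishburn order only passes through sets obeying a condition on each of
    their elements ([fishburn_scan]), and a word is a snake as soon as each of
    its letters follows an edge of the tiling. The number of words is found by
    dynamic programming on tables of states with multiplicities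
    ([size_words]), and the two numbers are evaluated and compared. *)

Set Implicit Arguments.
Unset Strict Implicit.
Unset Printing Implicit Defensive.

Import Order.TTheory GRing.Theory Num.Theory.

(** * Counting the words read along an automaton *)

Section Words.
Variables (V : eqType) (next : V -> seq nat) (add : V -> nat -> V).

Fixpoint words (r : nat) (v : V) : seq (seq nat) :=
  if r is r'.+1 then
    flatten [seq [seq c :: w | w <- words r' (add v c)] | c <- next v]
  else [:: [::]].

Fixpoint legal (v : V) (w : seq nat) : bool :=
  if w is c :: w' then (c \in next v) && legal (add v c) w' else true.

Lemma mem_words r v w : (w \in words r v) = (size w == r) && legal v w.
Proof.
elim: r v w => [|r IHr] v [|c w] //=.
  by apply/flatten_mapP => -[c _ /mapP[]].
rewrite eqSS; apply/flatten_mapP/idP => [[d dv /mapP[w' w'd [-> ->]]]|].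
  by rewrite dv /= -IHr.
case/and3P=> sz cv lw; exists c => //; apply/mapP; exists w => //.
by rewrite IHr sz.
Qed.

Lemma uniq_words r v : (forall v, uniq (next v)) -> uniq (words r v).
Proof.
move=> next_uniq; elim: r v => [|r IHr] v //=.
elim: (next v) (next_uniq v) => //= c s IHs /andP[c_s uniq_s].
rewrite cat_uniq IHs // andbT map_inj_uniq ?IHr //=; last by move=> ? ? [].
apply/hasPn => w /flatten_mapP[d d_s /mapP[w' _ ->]].
by apply: contraNN c_s => /mapP[w'' _ [<- _]].
Qed.

Fixpoint bump (v : V) (k : N) (tab : seq (V * N)) : seq (V * N) :=
  if tab is (v', k') :: tab' then
    if v == v' then (v', N.add k k') :: tab' else (v', k') :: bump v k tab'
  else [:: (v, k)].

Definition step (tab : seq (V * N)) : seq (V * N) :=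
  foldr (fun p acc => foldr (fun c => bump (add p.1 c) p.2) acc (next p.1))
        [::] tab.

Definition weight (tab : seq (V * N)) : N :=
  foldr (fun p acc => N.add p.2 acc) 0%num tab.

(** A table is a formal sum of states; a function on states extends to it
    linearly. *)
Definition value (g : V -> nat) (tab : seq (V * N)) : nat :=
  \sum_(p <- tab) N.to_nat p.2 * g p.1.

Lemma value_cons g p tab :
  value g (p :: tab) = N.to_nat p.2 * g p.1 + value g tab.
Proof. exact: big_cons. Qed.

Lemma value_bump g v k tab :
  value g (bump v k tab) = N.to_nat k * g v + value g tab.
Proof.
elim: tab => [|[v' k'] tab IHtab] /=.
  by rewrite /value big_seq1 big_nil addn0.
case: eqP => [->|_]; rewrite !value_cons /=.
  by rewrite N2Nat.inj_add mulnDl addnA.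
by rewrite IHtab addnCA.
Qed.

(** Reading one more letter moves the weight of a state to its successors, and
    the words of length r + 1 from a state are those of length r from its
    successors: the number of ways to finish is preserved at each step. *)
Lemma value_step r tab :
  value (fun v => size (words r v)) (step tab) =
  value (fun v => size (words r.+1 v)) tab.
Proof.
elim: tab => [|[v k] tab IHtab] /=; first by rewrite /value !big_nil.
rewrite value_cons -IHtab /= -/(step tab).
elim: (next v) => [|c s IHs] /=; first by rewrite muln0.
by rewrite value_bump IHs size_cat size_map mulnDr addnA.
Qed.

Lemma size_words r v :
  size (words r v) = N.to_nat (weight (iter r step [:: (v, 1%num)])).
Proof.
suff gen tab : value (fun v => size (words r v)) tab =
                  N.to_nat (weight (iter r step tab)).
  by rewrite -gen /value big_seq1 mul1n.
elim: r tab => [|r IHr] tab; last by rewrite -value_step IHr iterSr.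
elim: tab => [|[u k] tab IHtab]; first by rewrite /value big_nil.
by rewrite value_cons IHtab /= N2Nat.inj_add muln1.
Qed.

End Words.

Lemma legal_prefixes (V : eqType) (next : V -> seq nat) (add : V -> nat -> V)
    v w :
  (forall k, k < size w -> nth 0 w k \in next (foldl add v (take k w))) ->
  legal next add v w.
Proof.
elim: w v => [|c w IHw] v //= ok; rewrite (ok 0) //=.
by apply: IHw => k k_w; apply: (ok k.+1).
Qed.

Lemma ltn_to_nat (a b : N) : N.ltb a b -> (N.to_nat a < N.to_nat b)%N.
Proof.
move=> /N.ltb_lt ab; apply/ssrnat.ltP/PeanoNat.Nat.compare_lt_iff.
by rewrite -N2Nat.inj_compare.
Qed.

(** * Sets of letters as bit sequences *)

Definition indicator (n : nat) (u : seq nat) : bitseq :=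
  [seq k \in u | k <- iota 0 n].

Lemma nth_indicator n u k : k < n -> nth false (indicator n u) k = (k \in u).
Proof. by move=> k_n; rewrite (nth_map 0) ?size_iota // nth_iota. Qed.

Definition set_bit (b : bitseq) (c : nat) : bitseq := set_nth false b c true.

Lemma indicator_rcons n u c : c < n ->
  indicator n (rcons u c) = set_bit (indicator n u) c.
Proof.
move=> c_n; apply: (@eq_from_nth _ false) => [|k].
  by rewrite size_set_nth !size_map size_iota; apply/esym/maxn_idPr.
rewrite size_map size_iota => k_n.
rewrite nth_set_nth /= !nth_indicator // mem_rcons inE.
by case: eqP.
Qed.

Lemma eq_indicator n u u' : indicator n u = indicator n u' ->
  forall k, k < n -> (k \in u) = (k \in u').
Proof. by move=> uu' k k_n; rewrite -!(nth_indicator _ k_n) uu'. Qed.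

Lemma foldl_set_bit n u : all (fun c => c < n) u ->
  foldl set_bit (nseq n false) u = indicator n u.
Proof.
elim/last_ind: u => [|u c IHu]; last first.
  rewrite all_rcons foldl_rcons => /andP[c_n /IHu->].
  by rewrite indicator_rcons.
move=> _; apply: (@eq_from_nth _ false) => [|k]; rewrite size_nseq.
  by rewrite size_map size_iota.
by move=> k_n; rewrite nth_indicator // nth_nseq k_n.
Qed.

Definition nword n (s : linord n) : seq nat := map val (word s).

Lemma nword_inj n : injective (@nword n).
Proof. by move=> s s' /(inj_map val_inj)/val_inj/val_inj. Qed.

Lemma nword_uniq n (s : linord n) : uniq (nword s).
Proof. by rewrite (map_inj_uniq val_inj); case: s. Qed.

Lemma size_nword n (s : linord n) : size (nword s) = n.
Proof. by rewrite size_map size_tuple. Qed.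

Lemma nword_lt n (s : linord n) : all (fun c => c < n) (nword s).
Proof. by apply/allP => _ /mapP[i _ ->]; apply: ltn_ord. Qed.

Lemma mem_nword n (s : linord n) (i : 'I_n) : val i \in nword s.
Proof.
rewrite (mem_map val_inj).
have [] // := @uniq_min_size _ (word s) (enum 'I_n).
- by case: s.
- by move=> x _; rewrite mem_enum.
- by rewrite size_enum_ord size_tuple.
by move=> _ ->; rewrite mem_enum.
Qed.

(** * An upper bound for Fishburn's domain *)

Fixpoint constant_to (t : bool) (b : bitseq) : bool :=
  if b is x :: b' then if x == t then constant_to t b' else false else true.

(** The bits of a set S are scanned upwards, with [below] holding the bits
    already seen in reverse order and t the parity of the current ordinal j,
    whose label is j + 1. If the bit of j is t, that is, if j is in S and has
    an even label or is outside S and has an odd label, then all elements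
    below j or all elements above j must lie on the same side of S as j:
    otherwise some i < j < k have j alone in S, and j is the least of the
    three, or have j alone outside S, and j is the greatest. The conditionals
    stop early under call-by-value evaluation, unlike boolean connectives. *)
Fixpoint fishburn_scan (t : bool) (below above : bitseq) : bool :=
  if above is x :: above' then
    if (if x == t then
          if constant_to t below then true else constant_to t above'
        else true)
    then fishburn_scan (~~ t) (x :: below) above' else false
  else true.

Definition fishburn_next (b : bitseq) : seq nat :=
  [seq c <- iota 0 (size b) |
     if nth false b c then false else fishburn_scan false [::] (set_bit b c)].

Lemma constant_toP t b :
  reflect (forall k, k < size b -> nth false b k = t) (constant_to t b).
Proof.
elim: b => [|x b IHb] /=; first by apply: ReflectT.
case: eqP => [->|x_t]; last by apply: ReflectF => /(_ 0 isT).
apply: (iffP IHb) => [bt [|k] //|bt k k_b]; first exact: bt.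
exact: (bt k.+1).
Qed.

Lemma fishburn_scan_complete (S : nat -> bool) p q :
  (forall i j k, i < j < k -> k < p + q ->
     S j = odd j -> (S i == odd j) || (S k == odd j)) ->
  fishburn_scan (odd p) (rev [seq S k | k <- iota 0 p])
                [seq S k | k <- iota p q].
Proof.
elim: q p => [|q IHq] p //= S_ok.
rewrite ifT; last first.
  case: eqP => // Sp; case: constant_toP => //= not_below.
  apply/constant_toP => k; rewrite size_map size_iota => k_q.
  rewrite (nth_map 0) ?size_iota // nth_iota //; apply: contrapT => Sk.
  apply: not_below => i; rewrite size_rev size_map size_iota => i_p.
  rewrite nth_rev ?size_map ?size_iota // (nth_map 0) ?size_iota; last lia.
  rewrite nth_iota; last lia.
  have := S_ok (p - i.+1) p (p.+1 + k) ltac:(lia) ltac:(lia) Sp.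
  by case/orP=> /eqP.
have -> : S p :: rev [seq S k | k <- iota 0 p] =
          rev [seq S k | k <- iota 0 p.+1].
  by rewrite -addn1 iotaD map_cat rev_cat.
by apply: (IHq p.+1) => i j k ijk k_pq; apply: S_ok => //; lia.
Qed.

Definition phi (n : nat) : N :=
  weight (iter n (step fishburn_next set_bit) [:: (nseq n false, 1%num)]).

(** The peak and pit conditions speak of a triple i < j < k, and each of them
    forbids prefixes: j is the least of the three iff some prefix contains it
    alone, and the greatest iff some prefix contains i and k but not j. *)
Lemma fishburn_legal n (s : linord n) : s \in fishburn n ->
  legal fishburn_next set_bit (nseq n false) (nword s).
Proof.
rewrite inE => /forallP s_fish; apply: legal_prefixes => k.
rewrite size_nword => k_n; set w := nword s.
set u := take k w; set c := nth 0 w k.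
have sz_w : size w = n := size_nword s.
have c_n : c < n by apply: (allP (nword_lt s)); rewrite mem_nth ?sz_w.
have u_c : take k.+1 w = rcons u c by rewrite -take_nth ?sz_w.
have u_n : all (fun d => d < n) u.
  by apply/allP => d /mem_take /(allP (nword_lt s)).
rewrite foldl_set_bit // mem_filter mem_iota /= add0n size_map size_iota c_n.
rewrite andbT.
have c_u : c \notin u.
  have := take_uniq k.+1 (nword_uniq s).
  by rewrite -/w u_c rcons_uniq => /andP[].
rewrite nth_indicator // (negbTE c_u) -indicator_rcons // -u_c.
apply: (@fishburn_scan_complete (fun d => d \in take k.+1 w) 0 n).
move=> a b d /andP[ab bd]; rewrite add0n => d_n.
have b_n := ltn_trans bd d_n; have a_n := ltn_trans ab b_n.
have /forallP/(_ (Ordinal b_n))/forallP/(_ (Ordinal d_n)) :=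
  s_fish (Ordinal a_n).
rewrite /= ab bd /= /ord_lt -!(index_map val_inj) -/(nword s) -/w /= /label /=.
have inw (i : 'I_n) : val i \in w by apply: mem_nword.
rewrite !(in_take _ (inw (Ordinal _))).
by case: (odd b) => /=; do 2! [case: ltngtP]; lia.
Qed.

Lemma Phi_le n : Phi n <= N.to_nat (phi n).
Proof.
rewrite /phi -size_words /Phi cardE -(size_map (@nword n)).
apply: uniq_leq_size; first by rewrite (map_inj_uniq (@nword_inj n)) enum_uniq.
move=> w /mapP[s]; rewrite mem_enum => s_fish ->.
by rewrite mem_words size_nword eqxx fishburn_legal.
Qed.

(** * Sweeps of adjacent transpositions *)

(** The triple (u, i, j) stands for the rhombus with edges of colors i and j
    whose bottom vertex is the sum of the vectors with color in u. *)
Definition rhombus : Type := (seq nat * nat * nat)%type.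

Section Sweeps.
Variable n : nat.

(** Each step replaces two adjacent letters i < j of the word of the current
    path by j, i, and records the rhombus between the two paths. *)
Inductive sweep : seq nat -> seq rhombus -> seq nat -> Prop :=
| SweepNil w : sweep w [::] w
| SweepCons u i j v ts w' : i < j < n -> sweep (u ++ j :: i :: v) ts w' ->
    sweep (u ++ i :: j :: v) ((u, i, j) :: ts) w'.

Lemma sweep_perm w ts w' : sweep w ts w' -> perm_eq w w'.
Proof.
elim=> // u i j v {}ts {}w' _ _; apply: perm_trans; rewrite perm_cat2l.
by rewrite -[i :: _]/([:: i] ++ [:: j] ++ v) perm_catCA.
Qed.

Lemma sweep_cat w A B w' : sweep w (A ++ B) w' ->
  exists2 w1, sweep w A w1 & sweep w1 B w'.
Proof.
elim: A w => [|t A IHA] w /= sw; first by exists w => //; apply: SweepNil.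
inversion sw as [|u i j v ts w'' ij sw' e1 e2]; subst.
by have [w1 ? ?] := IHA _ sw'; exists w1 => //; apply: SweepCons.
Qed.

Lemma sweep_cons w u i j B w' : sweep w ((u, i, j) :: B) w' ->
  exists v, [/\ i < j < n, w = u ++ i :: j :: v &
                sweep (u ++ j :: i :: v) B w'].
Proof. by move=> sw; inversion sw as [|? ? ? v]; subst; exists v. Qed.

Definition left_edges (t : rhombus) : seq (seq nat * nat) :=
  let: (u, i, j) := t in [:: (u, i); (rcons u i, j)].

(** Vertices are given by words up to permutation, since only the set of
    letters determines the vertex. *)
Definition on_left_edge (ts : seq rhombus) (u : seq nat) (c : nat) : Prop :=
  exists t u', [/\ t \in ts, perm_eq u' u & (u', c) \in left_edges t].

Lemma cat_eq_cat (T : Type) (a b c d : seq T) : a ++ b = c ++ d ->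
  (exists r, c = a ++ r /\ b = r ++ d) \/ (exists r, a = c ++ r /\ d = r ++ b).
Proof.
elim: a c => [|x a IHa] [|y c] /=.
- by move=> ->; left; exists [::].
- by move=> ->; left; exists (y :: c).
- by move=> <-; right; exists (x :: a).
by case=> <- /IHa[[r [-> ->]]|[r [-> ->]]]; [left | right]; exists r.
Qed.

Lemma perm_swap (u : seq nat) i j r :
  perm_eq (u ++ j :: i :: r) (u ++ i :: j :: r).
Proof. by rewrite perm_cat2l -[j :: _]/([:: j] ++ [:: i] ++ r) perm_catCA. Qed.

(** An edge leaves the path only as a left edge of the rhombus that is jumped
    over; all other edges stay, up to the order of the letters before them. *)
Lemma sweep_edge w ts w' u c v : sweep w ts w' -> w = u ++ c :: v ->
  on_left_edge ts u c \/
  (exists u' v', perm_eq u' u /\ w' = u' ++ c :: v').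
Proof.
move=> sw; elim: sw u c v => {w ts w'} [w|u0 i j v0 ts w' _ _ IH] u c v.
  by move=> ->; right; exists u, v.
have keep u1 v1 : perm_eq u1 u -> u0 ++ j :: i :: v0 = u1 ++ c :: v1 ->
  on_left_edge ((u0, i, j) :: ts) u c \/
  (exists u' v', perm_eq u' u /\ w' = u' ++ c :: v').
- move=> u1u /IH[[t [u' [t_ts u'u1 ct]]]|[u' [v' [u'u1 ->]]]]; [left|right].
    by exists t, u'; rewrite inE t_ts orbT (perm_trans u'u1).
  by exists u', v'; rewrite (perm_trans u'u1).
have destroyed u' : perm_eq u' u -> (u', c) \in left_edges (u0, i, j) ->
  on_left_edge ((u0, i, j) :: ts) u c \/
  (exists u' v', perm_eq u' u /\ w' = u' ++ c :: v').
- by move=> u'u cu'; left; exists (u0, i, j), u'; rewrite mem_head.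
case/cat_eq_cat=> -[[|d [|e r]] [def_u def_w]]; case: def_w => *; subst.
- by apply: (destroyed u0); rewrite ?cats0 // mem_head.
- by apply: (destroyed (rcons u0 d)); rewrite ?cats1 // !inE eqxx orbT.
- by apply: (keep (u0 ++ [:: e, d & r]) v); rewrite ?perm_swap // -catA.
- by apply: (destroyed u); rewrite ?cats0 // mem_head.
- by apply: (keep u [:: j, i & v0]); rewrite // -catA.
by apply: (keep u (e :: r ++ [:: j, i & v0])); rewrite // -catA.
Qed.

(** A vertex leaves the path only as the left corner of a rhombus. *)
Lemma sweep_vertex w ts w' u v : sweep w ts w' -> w = u ++ v ->
  (exists u0 i j, (u0, i, j) \in ts /\ perm_eq (rcons u0 i) u) \/
  (exists u' v', perm_eq u' u /\ w' = u' ++ v').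
Proof.
move=> sw; elim: sw u v => {w ts w'} [w|u0 i j v0 ts w' _ _ IH] u v.
  by move=> ->; right; exists u, v.
have keep u1 v1 : perm_eq u1 u -> u0 ++ j :: i :: v0 = u1 ++ v1 ->
  (exists u2 k l, (u2, k, l) \in (u0, i, j) :: ts /\ perm_eq (rcons u2 k) u) \/
  (exists u' v', perm_eq u' u /\ w' = u' ++ v').
- move=> u1u /IH[[u2 [k [l [t_ts u2u1]]]]|[u' [v' [u'u1 ->]]]]; [left|right].
    by exists u2, k, l; rewrite inE t_ts orbT (perm_trans u2u1).
  by exists u', v'; rewrite (perm_trans u'u1).
case/cat_eq_cat=> -[[|d [|e r]] [def_u def_w]].
- by apply: (keep u0 [:: j, i & v0]); rewrite // def_u cats0.
- by case: def_w => -> _; left; exists u0, d, j; rewrite mem_head def_u cats1.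
- case: def_w => *; subst.
  by apply: (keep (u0 ++ [:: e, d & r]) v); rewrite ?perm_swap // -catA.
- by apply: (keep u [:: j, i & v0]); rewrite // def_u cats0.
- by apply: (keep u (d :: [:: j, i & v0])); rewrite // def_u -catA.
by apply: (keep u (d :: e :: r ++ [:: j, i & v0])); rewrite // def_u -catA.
Qed.

Lemma sweep_rhombus w ts w' u i j : sweep w ts w' -> (u, i, j) \in ts ->
  i < j < n /\ exists v, perm_eq w (u ++ i :: j :: v).
Proof.
move=> sw /path.splitPr t_ts; case: t_ts sw => A B.
case/sweep_cat=> w1 /sweep_perm w_w1.
by case/sweep_cons=> v [ij w1E _]; split=> //; exists v; rewrite -w1E.
Qed.

Fixpoint run (w : seq nat) (ps : seq nat) : seq rhombus * seq nat :=
  if ps is p :: ps' then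
    if drop p w is i :: j :: v then
      let: (ts, w') := run (take p w ++ j :: i :: v) ps' in
      ((take p w, i, j) :: ts, w')
    else ([::], w)
  else ([::], w).

Lemma run_sweep w ps :
  all (fun t : rhombus => t.1.2 < t.2 < n) (run w ps).1 ->
  sweep w (run w ps).1 (run w ps).2.
Proof.
elim: ps w => [|p ps IHps] w /=; first by move=> _; apply: SweepNil.
case w_p: (drop p w) => [|i [|j v]]; try by move=> _; apply: SweepNil.
case: (run _ ps) (IHps (take p w ++ [:: j, i & v])) => ts w' /= IH.
case/andP=> ij /IH sw.
by rewrite -{1}(cat_take_drop p w) w_p; apply: SweepCons.
Qed.

End Sweeps.

(** * Words that leave each vertex along a left edge of a rhombus *)

(** Every edge of a swept tiling, apart from the right boundary of the zonogon,
    is a left edge of some rhombus. Listing left edges only keeps the table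
    short at the price of the snakes that use the right boundary. *)
Definition edge_table (n : nat) (ts : seq rhombus) : seq (bitseq * nat) :=
  flatten [seq [seq (indicator n e.1, e.2) | e <- left_edges t] | t <- ts].

Definition snake_next (E : seq (bitseq * nat)) (b : bitseq) : seq nat :=
  undup [seq e.2 | e <- E & e.1 == b].

Definition left_snakes n (ts : seq rhombus) : N :=
  let E := edge_table n ts in
  weight (iter n (step (snake_next E) set_bit) [:: (nseq n false, 1%num)]).

Lemma left_edge_uniq n ts w' t u c : sweep n (iota 0 n) ts w' -> t \in ts ->
  (u, c) \in left_edges t ->
  uniq (rcons u c) /\ all (fun k => k < n) (rcons u c).
Proof.
case: t => [[u0 i] j] sw t_ts u_c.
have [_ [v w_uv]] := sweep_rhombus sw t_ts.
have [v' w_uv'] : exists v', perm_eq (iota 0 n) (rcons u c ++ v').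
  move: u_c; rewrite !inE => /orP[] /eqP[-> ->].
    by exists (j :: v); rewrite cat_rcons.
  by exists v; rewrite !cat_rcons.
split.
  by have := iota_uniq 0 n; rewrite (perm_uniq w_uv') cat_uniq => /and3P[].
apply/allP => k k_u.
have : k \in iota 0 n by rewrite (perm_mem w_uv') mem_cat k_u.
by rewrite mem_iota.
Qed.

(** The automaton only knows sets of letters. That a word it accepts repeats no
    letter is due to the sweep: the words of its paths are permutations, so a
    color leaving a vertex is not among the colors leading to it. *)
Lemma legal_left_snake n ts w' u v : sweep n (iota 0 n) ts w' ->
  uniq u -> all (fun k => k < n) u ->
  legal (snake_next (edge_table n ts)) set_bit (indicator n u) v ->
  [/\ uniq (u ++ v), all (fun k => k < n) (u ++ v) &
      forall v1 c v2, v = v1 ++ c :: v2 -> on_left_edge ts (u ++ v1) c].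
Proof.
move=> sw; elim: v u => [|c v IHv] u u_uniq u_n /=.
  by rewrite cats0 => _; split=> // -[|? ?].
case/andP; rewrite mem_undup => /mapP[[b d]]; rewrite mem_filter /=.
move=> + c_d; case/andP=> /eqP-> /flatten_mapP[t t_ts].
case/mapP=> -[u' e] u'_c /= [eq_u def_d].
move: c_d => /=; rewrite def_d => -> {b d def_d}.
have [] := left_edge_uniq sw t_ts u'_c.
rewrite rcons_uniq all_rcons => /andP[e_u' u'_uniq] /andP[e_n u'_n].
have u'u : perm_eq u' u.
  apply: uniq_perm => // k; apply/idP/idP => k_u.
    by rewrite (eq_indicator eq_u) // (allP u'_n).
  by rewrite -(eq_indicator eq_u) // (allP u_n).
rewrite -indicator_rcons // => /IHv[].
- by rewrite rcons_uniq u_uniq -(perm_mem u'u) e_u'.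
- by rewrite all_rcons e_n.
rewrite !cat_rcons => uv_uniq uv_n edges; split=> //.
move=> [|d v1] c' v2 /= [<- def_v]; last first.
  by rewrite -cat_rcons; apply: (edges _ _ _ def_v).
by exists t, u'; rewrite cats0.
Qed.

(** * The concatenation of two brick walls *)

(** Odd-even transposition sort of m letters in the positions lo, lo + 1, ...;
    the first round exchanges the positions 1 and 2, 3 and 4, ... counted
    from 0. For lo = 0 the snakes of the resulting tiling form Fishburn's
    domain. *)
Definition brick_wall (lo m : nat) : seq nat :=
  flatten [seq [seq lo + p | p <- iota 0 m.-1 & odd p != odd k]
          | k <- iota 0 m].

(** Once both halves are sorted in decreasing order, each letter of the upper
    half, starting with the largest one, moves down past the whole lower
    half. *)
Definition crossing (m : nat) : seq nat :=
  flatten [seq rev (iota k m) | k <- iota 0 m].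

Definition schedule (m : nat) : seq nat :=
  brick_wall 0 m ++ brick_wall m m ++ crossing m.

Definition rhombi (m : nat) : seq rhombus :=
  (run (iota 0 (m + m)) (schedule m)).1.

Lemma rhombi_sweep : sweep 42 (iota 0 42) (rhombi 21) (rev (iota 0 42)).
Proof.
have <- : (run (iota 0 (21 + 21)) (schedule 21)).2 = rev (iota 0 42).
  by vm_compute.
by apply: run_sweep; vm_compute.
Qed.

(** * Monotone paths as graphs over the height *)

Local Open Scope classical_set_scope.
Local Open Scope ring_scope.

Section Paths.
Variables (R : realFieldType) (s y : nat -> R).
Hypothesis y_gt0 : forall c, 0 < y c.

Definition clip (l h : R) : R :=
  if h <= 0 then 0 else if h <= l then h else l.

Definition height (u : seq nat) : R := \sum_(c <- u) y c.

(** The horizontal coordinate at height h of the path from the origin with word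
    w, where the color c has slope s c (horizontal over vertical) and vertical
    extent y c. Clipping makes an edge contribute nothing below its range and
    its full displacement above it, so that words can be concatenated without
    any condition on h. *)
Fixpoint path_at (w : seq nat) (h : R) : R :=
  if w is c :: w' then s c * clip (y c) h + path_at w' (h - y c) else 0.

Lemma height_nil : height [::] = 0.
Proof. exact: big_nil. Qed.

Lemma height_cons c u : height (c :: u) = y c + height u.
Proof. exact: big_cons. Qed.

Lemma height_cat u v : height (u ++ v) = height u + height v.
Proof. exact: big_cat. Qed.

Lemma height_rcons u c : height (rcons u c) = height u + y c.
Proof. by rewrite -cats1 height_cat /height big_seq1. Qed.

Lemma height_ge0 u : 0 <= height u.
Proof. by apply: sumr_ge0 => c _; apply: ltW. Qed.

Lemma height_perm u v : perm_eq u v -> height u = height v.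
Proof. by move=> uv; apply: perm_big. Qed.

Lemma path_at_cat u v h :
  path_at (u ++ v) h = path_at u h + path_at v (h - height u).
Proof.
elim: u h => [|c u IHu] h /=; first by rewrite /height big_nil subr0 add0r.
by rewrite IHu height_cons opprD !addrA.
Qed.

Lemma path_at_bottom w h : h <= 0 -> path_at w h = 0.
Proof.
elim: w h => [|c w IHw] h h_le0 //=.
have := y_gt0 c; rewrite /clip h_le0 mulr0 add0r => yc; apply: IHw; lra.
Qed.

Lemma path_at_top w h : height w <= h -> path_at w h = \sum_(c <- w) s c * y c.
Proof.
elim: w h => [|c w IHw] h; first by rewrite big_nil.
rewrite height_cons big_cons /= => h_top.
have := y_gt0 c; have := height_ge0 w => w_ge0 yc; rewrite IHw; last lra.
congr (_ * _ + _); rewrite /clip; case: (lerP h 0) => ?; first lra.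
by case: (lerP h (y c)) => ?; lra.
Qed.

Lemma path_at_vertex u v :
  path_at (u ++ v) (height u) = \sum_(c <- u) s c * y c.
Proof. by rewrite path_at_cat path_at_top // subrr path_at_bottom // addr0. Qed.

Lemma path_at_edge u c v h : height u <= h <= height u + y c ->
  path_at (u ++ c :: v) h = (\sum_(d <- u) s d * y d) + s c * (h - height u).
Proof.
case/andP=> uh hc; rewrite path_at_cat path_at_top //=.
rewrite (path_at_bottom v); last lra.
congr (_ + _); rewrite addr0; congr (_ * _); rewrite /clip.
by case: lerP => ?; [lra | rewrite ifT //; lra].
Qed.

(** The two sides of a rhombus with colors i < j are bend i j on the left and
    bend j i on the right. *)
Definition bend (i j : nat) (h : R) : R := path_at [:: i; j] h.

Lemma path_at_flip u i j v h :
  path_at (u ++ j :: i :: v) h - path_at (u ++ i :: j :: v) h =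
  bend j i (h - height u) - bend i j (h - height u).
Proof.
rewrite !path_at_cat /bend /= !addr0 -!(addrAC _ (- y j) (- y i)).
lra.
Qed.

Lemma clipD i j h : clip (y i + y j) h = clip (y i) h + clip (y j) (h - y i).
Proof.
have yi := y_gt0 i; have yj := y_gt0 j.
by rewrite /clip; do ![case: lerP => ?]; lra.
Qed.

Lemma bendE i j h :
  bend i j h = s j * clip (y i + y j) h - (s j - s i) * clip (y i) h.
Proof. by rewrite /bend /= clipD; ring. Qed.

Lemma clip_overlap i j h : clip (y i + y j) h <= clip (y i) h + clip (y j) h.
Proof.
have yi := y_gt0 i; have yj := y_gt0 j.
rewrite /clip; case: (lerP h 0) => ?; case: (lerP h (y i)) => ?;
  by case: (lerP h (y j)) => ?; case: (lerP h (y i + y j)) => ?; lra.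
Qed.

(** The factor of s j - s i is the amount by which the two clipped heights
    overlap; it vanishes outside the height range of the rhombus and is
    positive inside. *)
Lemma bendB i j h : bend j i h - bend i j h =
  (s j - s i) * (clip (y i) h + clip (y j) h - clip (y i + y j) h).
Proof. by rewrite !bendE (addrC (y j)); ring. Qed.

Variables (n : nat).
Hypothesis s_mono : forall i j, (i < j < n)%N -> s i < s j.

Lemma bend_flip i j h : (i < j < n)%N -> bend i j h <= bend j i h.
Proof.
move=> /s_mono sij; rewrite -subr_ge0 bendB mulr_ge0 ?subr_ge0 ?clip_overlap //.
exact: ltW.
Qed.

Lemma bend_flip_lt i j h : (i < j < n)%N -> 0 < h < y i + y j ->
  bend i j h < bend j i h.
Proof.
move=> /s_mono sij /andP[h0 h1]; have yi := y_gt0 i; have yj := y_gt0 j.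
rewrite -subr_gt0 bendB mulr_gt0 ?subr_gt0 // /clip.
case: (lerP h 0) => ?; case: (lerP h (y i)) => ?;
  by case: (lerP h (y j)) => ?; case: (lerP h (y i + y j)) => ?; lra.
Qed.

Lemma bend_flip_out i j h : h <= 0 \/ y i + y j <= h -> bend i j h = bend j i h.
Proof.
have yi := y_gt0 i; have yj := y_gt0 j.
move=> h_out; apply/esym/eqP; rewrite -subr_eq0 bendB mulf_eq0.
apply/orP; right.
apply/eqP; rewrite /clip; case: h_out => ?; case: (lerP h 0) => ?;
  case: (lerP h (y i)) => ?; case: (lerP h (y j)) => ?;
  by case: (lerP h (y i + y j)) => ?; lra.
Qed.

(** Lying between the two sides at height h amounts to four linear
    inequalities, one for each edge line of the rhombus. *)
Lemma bend_rhombus i j h x : (i < j < n)%N -> 0 <= h <= y i + y j ->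
  (bend i j h <= x <= bend j i h) =
  (0 <= x - s i * h <= (s j - s i) * y j) &&
  (0 <= s j * h - x <= (s j - s i) * y i).
Proof.
move=> /s_mono sij /andP[h0 h1]; have yi := y_gt0 i; have yj := y_gt0 j.
have d_gt0 : 0 < s j - s i by rewrite subr_gt0.
have d_le a b : a <= b -> (s j - s i) * a <= (s j - s i) * b.
  by move=> ab; rewrite ler_pM2l.
have hE : clip (y i + y j) h = h.
  rewrite /clip h1; case: lerP => // ?.
  by apply/esym/eqP; rewrite eq_le h0 andbT.
have low : (bend i j h <= x) =
    (0 <= x - s i * h) && (s j * h - x <= (s j - s i) * y i).
  rewrite bendE hE /clip; case: (lerP h 0) => ?; last case: (lerP h (y i)) => ?.
  - have := d_le _ _ (ltW yi); have -> : h = 0 by lra.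
    by move=> ?; apply/idP/andP => [?|[? ?]]; [split; lra | lra].
  - have := d_le h (y i) ltac:(lra).
    by move=> ?; apply/idP/andP => [?|[? ?]]; [split; lra | lra].
  - have := d_le (y i) h ltac:(lra).
    by move=> ?; apply/idP/andP => [?|[? ?]]; [split; lra | lra].
have high : (x <= bend j i h) =
    (0 <= s j * h - x) && (x - s i * h <= (s j - s i) * y j).
  rewrite bendE (addrC (y j)) hE /clip.
  case: (lerP h 0) => ?; last case: (lerP h (y j)) => ?.
  - have := d_le _ _ (ltW yj); have -> : h = 0 by lra.
    by move=> ?; apply/idP/andP => [?|[? ?]]; [split; lra | lra].
  - have := d_le h (y j) ltac:(lra).
    by move=> ?; apply/idP/andP => [?|[? ?]]; [split; lra | lra].
  - have := d_le (y j) h ltac:(lra).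
    by move=> ?; apply/idP/andP => [?|[? ?]]; [split; lra | lra].
by rewrite low high -!andbA; do !bool_congr.
Qed.

End Paths.

(** * The two extreme paths bound the zonogon *)

Section Envelope.
Variables (R : realFieldType) (s y : nat -> R).
Hypothesis y_gt0 : forall c, 0 < y c.
Implicit Types (w : seq nat).

Lemma clip_mono (l a b : R) : 0 <= l -> a <= b -> clip l a <= clip l b.
Proof.
move=> l0 ab; rewrite /clip; case: (lerP a 0) => ?; case: (lerP a l) => ?;
  by case: (lerP b 0) => ?; case: (lerP b l) => ?; lra.
Qed.

Lemma clip_id (l a : R) : 0 <= a <= l -> clip l a = a.
Proof. by case/andP=> ? al; rewrite /clip al; case: lerP => ?; lra. Qed.

Lemma clip_cons c w h :
  clip (height y (c :: w)) h = clip (y c) h + clip (height y w) (h - y c).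
Proof.
have yc := y_gt0 c; have yw := height_ge0 y_gt0 w; rewrite height_cons /clip.
case: (lerP h 0) => ?; case: (lerP h (y c)) => ?;
  by case: (lerP (h - y c) 0) => ?; case: (lerP h (y c + height y w)) => ?;
     case: (lerP (h - y c) (height y w)) => ?; lra.
Qed.

(** Along edges of slope at least s0, the path advances by at least s0 times
    the height climbed, which clipping restricts to the range of the path. *)
Lemma path_at_slope s0 w a b : all (fun c => s0 <= s c) w -> a <= b ->
  s0 * (clip (height y w) b - clip (height y w) a) <=
  path_at s y w b - path_at s y w a.
Proof.
elim: w a b => [|c w IHw] a b /=.
  rewrite !height_nil /clip => _ ab.
  by case: (lerP a 0) => ?; case: (lerP b 0) => ?; lra.
case/andP=> s0c /IHw{}IHw ab; rewrite !clip_cons.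
have := IHw (a - y c) (b - y c) ltac:(lra).
have : 0 <= (s c - s0) * (clip (y c) b - clip (y c) a).
  by rewrite mulr_ge0 ?subr_ge0 // clip_mono // ltW.
lra.
Qed.

(** A point of the zonogon is reached by climbing only a part a c of each edge.
    Climbing the same total height along the edges of least slope first goes
    least far to the right. *)
Lemma path_at_convex w (a : nat -> R) : pairwise (fun c d => s c <= s d) w ->
  (forall c, 0 <= a c <= y c) ->
  path_at s y w (\sum_(c <- w) a c) <= \sum_(c <- w) s c * a c.
Proof.
move=> + a_y; elim: w => [|c w IHw] /=; first by rewrite !big_nil.
rewrite !big_cons => /andP[s_c /IHw{}IHw].
set h' := \sum_(c <- w) a c in IHw *.
have h'_w : 0 <= h' <= height y w.
  rewrite sumr_ge0 /=; last by move=> d _; case/andP: (a_y d).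
  by apply: ler_sum => d _; case/andP: (a_y d).
have /andP[ac0 acy] := a_y c; have /andP[h0 h1] := h'_w.
have := @path_at_slope (s c) w (a c + h' - y c) h' s_c ltac:(lra).
have := clip_cons c w (a c + h').
rewrite [clip _ h']clip_id // clip_id ?height_cons; last lra.
move=> e; have -> : clip (height y w) (a c + h' - y c) =
                    a c + h' - clip (y c) (a c + h') by lra.
lra.
Qed.

End Envelope.

Lemma path_atN (R : realFieldType) (s y : nat -> R) w h :
  path_at (fun c => - s c) y w h = - path_at s y w h.
Proof. by elim: w h => [|c w IHw] h /=; rewrite ?oppr0 // IHw; ring. Qed.

(** Reflection in the vertical axis turns increasing slopes into decreasing
    ones. *)
Lemma path_at_concave (R : realFieldType) (s y : nat -> R) w (a : nat -> R) :
  (forall c, 0 < y c) -> pairwise (fun c d => s d <= s c) w ->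
  (forall c, 0 <= a c <= y c) ->
  \sum_(c <- w) s c * a c <= path_at s y w (\sum_(c <- w) a c).
Proof.
move=> y_gt0 s_w a_y.
have := @path_at_convex _ (fun c => - s c) y y_gt0 w a.
have -> : \sum_(c <- w) - s c * a c = - \sum_(c <- w) s c * a c.
  by rewrite -sumrN; apply: eq_bigr => c _; rewrite mulNr.
rewrite path_atN lerN2; apply=> //.
by apply: sub_pairwise s_w => c d; rewrite lerN2.
Qed.

(** * The paths of a sweep *)

Section SweepPaths.
Variables (R : realFieldType) (s y : nat -> R) (n : nat).
Hypothesis y_gt0 : forall c, 0 < y c.
Hypothesis s_mono : forall i j, (i < j < n)%N -> s i < s j.
Local Notation path_at := (path_at s y).
Local Notation bend := (bend s y).
Local Notation height := (height y).

Definition abscissa (u : seq nat) : R := \sum_(c <- u) s c * y c.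

Lemma abscissa_perm u v : perm_eq u v -> abscissa u = abscissa v.
Proof. by move=> uv; apply: perm_big. Qed.

Definition in_rhombus (t : rhombus) (x h : R) : bool :=
  let: (u, i, j) := t in
  (height u <= h <= height u + (y i + y j)) &&
  (bend i j (h - height u) <= x - abscissa u <= bend j i (h - height u)).

Lemma path_at_bend u i j v h : height u <= h <= height u + (y i + y j) ->
  path_at (u ++ i :: j :: v) h = abscissa u + bend i j (h - height u).
Proof.
case/andP=> h0 h1; rewrite path_at_cat (path_at_top _ y_gt0) // /bend /=.
by rewrite (path_at_bottom _ y_gt0 v) //; lra.
Qed.

(** This is where increasing slopes are needed: exchanging i < j moves the path
    to the right. *)
Lemma sweep_le w ts w' h : sweep n w ts w' -> path_at w h <= path_at w' h.
Proof.
elim=> // u i j v {}ts {}w' ij _; apply: le_trans.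
by rewrite -subr_ge0 path_at_flip subr_ge0; apply: bend_flip ij.
Qed.

Lemma sweep_rhombus_bounds w ts w' t x h : sweep n w ts w' -> t \in ts ->
  in_rhombus t x h -> path_at w h <= x <= path_at w' h.
Proof.
move=> sw /path.splitPr t_ts; case: t t_ts sw => [[u i] j] [A B].
case/sweep_cat=> w1 /sweep_le w_w1 /sweep_cons[v [ij def_w1 /sweep_le w2_w']].
case/andP=> h_t /andP[x0 x1].
have := w2_w' h; have := w_w1 h; rewrite def_w1 !path_at_bend //; last first.
  by rewrite (addrC (y j)).
by move=> ? ?; apply/andP; split; lra.
Qed.

Lemma sweep_lt w ts w' u i j h : sweep n w ts w' -> (u, i, j) \in ts ->
  height u < h < height u + (y i + y j) -> path_at w h < path_at w' h.
Proof.
move=> sw t_ts h_t; have [ij _] := sweep_rhombus sw t_ts.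
have lt_bend : bend i j (h - height u) < bend j i (h - height u).
  by apply: (bend_flip_lt y_gt0 s_mono ij); lra.
have in_t x : bend i j (h - height u) <= x <= bend j i (h - height u) ->
    path_at w h <= abscissa u + x <= path_at w' h.
  move=> x_t; apply: (sweep_rhombus_bounds sw t_ts).
  by rewrite /in_rhombus [abscissa u + x]addrC addrK x_t andbT; lra.
have /andP[l _] := in_t (bend i j (h - height u)) ltac:(rewrite lexx ltW //).
have /andP[_ r] := in_t (bend j i (h - height u)) ltac:(rewrite lexx ltW //).
lra.
Qed.

(** Between the first and the last path, a point is jumped over by the first
    step that brings the path to its right or onto it; that step moves the
    path at this height, which is therefore in the range of its rhombus. *)
Lemma sweep_cover w ts w' x h : sweep n w ts w' ->
  path_at w h < x <= path_at w' h ->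
  exists2 t, t \in ts & in_rhombus t x h.
Proof.
move=> sw; elim: sw => {w ts w'} [w|u i j v ts w' ij _ IH] /andP[wx xw'].
  by move: (lt_le_trans wx xw'); rewrite ltxx.
have flip := path_at_flip s y u i j v h.
have [w1x|xw1] := ltrP (path_at (u ++ j :: i :: v) h) x.
  have [t t_ts xt] := IH ltac:(rewrite w1x xw' //).
  by exists t; rewrite // inE t_ts orbT.
exists (u, i, j); first exact: mem_head.
have h_t : height u <= h <= height u + (y i + y j).
  apply: contraT => h_out.
  have E := @bend_flip_out _ s y y_gt0 i j (h - height u).
  suff: bend i j (h - height u) = bend j i (h - height u) by lra.
  by apply: E; case: (lerP (height u) h) h_out => ? h_out; [right | left]; lra.
rewrite /in_rhombus h_t /=; move: wx xw1.
rewrite !path_at_bend //; last by rewrite (addrC (y j)).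
by move=> ? ?; apply/andP; split; lra.
Qed.

Lemma left_edge_in_rhombus t u c h : (t.1.2 < t.2 < n)%N ->
  (u, c) \in left_edges t ->
  height u <= h <= height u + y c ->
  in_rhombus t (abscissa u + s c * (h - height u)) h.
Proof.
case: t => [[u0 i] j] /= ij; rewrite !inE.
have le_bend := bend_flip y_gt0 s_mono _ ij.
have yi := y_gt0 i; have yj := y_gt0 j.
case/orP=> /eqP[-> ->] h_c;
  have h_t : height u0 <= h <= height u0 + (y i + y j).
- lra.
- rewrite h_t /=; have := @path_at_bend u0 i j [::] h h_t.
  rewrite (path_at_edge _ y_gt0) // -/(abscissa _) => E.
  by have := le_bend (h - height u0); move=> ?; apply/andP; split; lra.
- by move: h_c; rewrite height_rcons; lra.
rewrite h_t /=; have := @path_at_bend u0 i j [::] h h_t.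
rewrite -cat_rcons (path_at_edge _ y_gt0) // -/(abscissa _) => E.
by have := le_bend (h - height u0); move=> ?; apply/andP; split; lra.
Qed.

Lemma edge_at w h : 0 <= h <= height w -> w != [::] ->
  exists u c v, w = u ++ c :: v /\ height u <= h <= height u + y c.
Proof.
elim: w h => // c [|d w] IHw h /andP[h0 h1] _.
  exists [::], c, [::]; split=> //.
  by move: h1; rewrite height_cons height_nil; lra.
have [hc|hc] := lerP h (y c).
  by exists [::], c, (d :: w); split=> //; rewrite /height big_nil; lra.
have [||u [e [v [-> h_e]]]] := IHw (h - y c) => //.
  by move: h1; rewrite height_cons; lra.
by exists (c :: u), e, v; split=> //; rewrite height_cons; lra.
Qed.

End SweepPaths.

(** * Contacts between two rhombi of a sweep *)

Definition left_vertices (t : rhombus) : seq (seq nat) :=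
  let: (u, i, j) := t in [:: u; rcons u i; rcons (rcons u i) j].

(** Exchanging the colors turns the right side of a rhombus into the left side
    of its mirror image. *)
Definition mirror (t : rhombus) : rhombus := (t.1.1, t.2, t.1.2).

Section SweepMeet.
Variables (R : realFieldType) (s y : nat -> R) (n : nat).
Hypothesis y_gt0 : forall c, 0 < y c.
Hypothesis s_mono : forall i j, (i < j < n)%N -> s i < s j.
Local Notation path_at := (path_at s y).
Local Notation bend := (bend s y).
Local Notation height := (height y).
Local Notation abscissa := (abscissa s y).
Local Notation in_rhombus := (in_rhombus s y).

Lemma prefix_left_vertex u i j v z r : u ++ i :: j :: v = z ++ r ->
  height u <= height z <= height u + (y i + y j) ->
  z \in left_vertices (u, i, j).
Proof.
case/cat_eq_cat=> -[[|d [|e [|f r0]]] [def_z def_w]]; subst;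
  rewrite ?cats0 ?height_cat ?height_cons ?height_nil => /andP[h0 h1].
- exact: mem_head.
- by case: def_w => <- _; rewrite cats1 !inE eqxx orbT.
- by case: def_w => <- <- _; rewrite -cat_rcons cats1 !inE eqxx !orbT.
- case: def_w => ? ? _; subst; have := y_gt0 f; have := height_ge0 y_gt0 r0.
  by lra.
- exact: mem_head.
- by have := y_gt0 d; move: h0; rewrite ?height_cons ?height_nil; lra.
- have := y_gt0 d; have := y_gt0 e.
  by move: h0; rewrite ?height_cons ?height_nil; lra.
have := y_gt0 d; have := y_gt0 e; have := y_gt0 f; have := height_ge0 y_gt0 r0.
by move: h0; rewrite ?height_cons ?height_nil; lra.
Qed.

Lemma prefix_left_edge u i j v z c r h : u ++ i :: j :: v = z ++ c :: r ->
  height z < h < height z + y c -> height u <= h <= height u + (y i + y j) ->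
  (z, c) \in left_edges (u, i, j).
Proof.
case/cat_eq_cat=> -[[|d [|e r0]] [def_z def_w]]; case: def_w => *; subst;
  rewrite ?cats0 ?cats1 !inE ?eqxx ?orbT //.
- exfalso; have := height_ge0 y_gt0 r0; move: (y_gt0 e).
  have : height (u ++ [:: d, e & r0]) = height u + (y d + (y e + height r0)).
    by rewrite height_cat !height_cons.
  lra.
- have : height (z ++ [:: d]) = height z + y d by rewrite cats1 height_rcons.
  lra.
have := height_ge0 y_gt0 r0; move: (y_gt0 e).
have : height (z ++ [:: d, e & r0]) = height z + (y d + (y e + height r0)).
  by rewrite height_cat !height_cons.
lra.
Qed.

(** All paths between the two steps pass to the right of the first rhombus and
    to the left of the second one. At a common point they are squeezed
    together, so no step in between moves the path at this height. The vertex
    or the edge of the path found at this height after the first step is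
    hence still there before the second one, where it belongs to the left
    side of the second rhombus. *)
Lemma rhombi_contact w t1 B t2 C w' x h : sweep n w (t1 :: B ++ t2 :: C) w' ->
  in_rhombus t1 x h -> in_rhombus t2 x h ->
  (exists u1 u2 c, [/\ (u1, c) \in left_edges (mirror t1),
                       (u2, c) \in left_edges t2 & perm_eq u1 u2]) \/
  (exists z1 z2, [/\ z1 \in left_vertices (mirror t1), z2 \in left_vertices t2,
                     perm_eq z1 z2, h = height z1 & x = abscissa z1]).
Proof.
case: t1 t2 => [[u1 i1] j1] [[u2 i2] j2] /sweep_cons[v1 [ij1 _ sw]] in1 in2.
have {sw} [w2' swB /sweep_cons[v2 [ij2 def_w2 _]]] := sweep_cat sw.
rewrite {}def_w2 in swB; set w1 := u1 ++ _ in swB; set w2 := u2 ++ _ in swB.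
have w12 := sweep_le y_gt0 s_mono h swB.
case/andP: (in1) => h1 /andP[_ x1]; case/andP: (in2) => h2 /andP[x2 _].
have path1 : path_at w1 h = abscissa u1 + bend j1 i1 (h - height u1).
  by rewrite path_at_bend // (addrC (y j1)).
have path2 : path_at w2 h = abscissa u2 + bend i2 j2 (h - height u2).
  by rewrite path_at_bend.
have xE : path_at w1 h = x by lra.
(* A rhombus of B with h strictly inside its range would push the path
   strictly to the right at height h. *)
have untouched u i j : (u, i, j) \in B ->
    ~ height u < h < height u + (y i + y j).
  by move=> t_B /(sweep_lt y_gt0 s_mono swB t_B); lra.
have at_vertex z1 r : w1 = z1 ++ r -> h = height z1 ->
    exists z2, [/\ z2 \in left_vertices (u2, i2, j2), perm_eq z1 z2,
                   h = height z1 & x = abscissa z1].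
  move=> def_w1 hE; case: (sweep_vertex swB def_w1) => [[u [i [j [t_B z1E]]]]|].
    have := height_perm y z1E; rewrite height_rcons => ?.
    by have := untouched _ _ _ t_B; have := y_gt0 i; have := y_gt0 j; lra.
  case=> z2 [r2 [z21 def_w2]]; have h21 := height_perm y z21.
  exists z2; split; rewrite // 1?perm_sym //.
    by apply: (prefix_left_vertex def_w2); rewrite h21 -hE.
  by rewrite -xE def_w1 hE path_at_vertex.
have at_edge z1 c r : w1 = z1 ++ c :: r -> height z1 < h < height z1 + y c ->
    exists z2, (z2, c) \in left_edges (u2, i2, j2) /\ perm_eq z1 z2.
  move=> def_w1 hE.
  case: (sweep_edge swB def_w1) => [[[[u i] j] [z [t_B z1E zc]]]|].
    have h_z := height_perm y z1E; exfalso; apply: (untouched _ _ _ t_B).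
    have yi := y_gt0 i; have yj := y_gt0 j.
    move: zc; rewrite !inE => /orP[] /eqP[? ?]; subst; first by lra.
    by move: h_z; rewrite height_rcons => ?; lra.
  case=> z2 [r2 [z21 def_w2]]; have h21 := height_perm y z21.
  exists z2; split; rewrite 1?perm_sym //.
  by apply: (prefix_left_edge def_w2 (h := h)); rewrite ?h21.
have hr1 := height_rcons y u1 j1; have hr2 := height_rcons y (rcons u1 j1) i1.
have vertex1 z1 r : z1 \in left_vertices (mirror (u1, i1, j1)) ->
    w1 = z1 ++ r -> h = height z1 ->
  exists z1 z2, [/\ z1 \in left_vertices (mirror (u1, i1, j1)),
                    z2 \in left_vertices (u2, i2, j2), perm_eq z1 z2,
                    h = height z1 & x = abscissa z1].
  by move=> z1_t def_w1 /(at_vertex _ _ def_w1)[z2 []]; exists z1, z2.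
have edge1 z1 c r : (z1, c) \in left_edges (mirror (u1, i1, j1)) ->
    w1 = z1 ++ c :: r -> height z1 < h < height z1 + y c ->
  exists u1' u2' c', [/\ (u1', c') \in left_edges (mirror (u1, i1, j1)),
                         (u2', c') \in left_edges (u2, i2, j2) &
                         perm_eq u1' u2'].
  by move=> z1_t def_w1 /(at_edge _ _ _ def_w1)[z2 []]; exists z1, z2, c.
have [E0|] := eqVneq h (height u1).
  by right; apply: (vertex1 u1 [:: j1, i1 & v1]); rewrite ?mem_head.
have [E1|] := eqVneq h (height (rcons u1 j1)).
  right; apply: (vertex1 (rcons u1 j1) (i1 :: v1)); rewrite ?cat_rcons //.
  by rewrite !inE eqxx orbT.
have [E2|] := eqVneq h (height (rcons (rcons u1 j1) i1)).
  by right; apply: (vertex1 _ v1 _ _ E2); rewrite ?cat_rcons // !inE eqxx !orbT.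
move=> n2 n1 n0; left; have [hm|hm] := ltrP h (height (rcons u1 j1)).
  by apply: (edge1 u1 j1 (i1 :: v1)); rewrite ?mem_head //; lra.
apply: (edge1 (rcons u1 j1) i1 v1); rewrite ?cat_rcons ?inE ?eqxx ?orbT //.
lra.
Qed.

End SweepMeet.

(** * Rhombi in the plane *)

Section Tiling.
Variables (R : realType) (m : nat) (xi : 'I_m.+1 -> 'rV[R]_2).
Hypothesis xi_adm : admissible xi.
Local Notation n := m.+1.
Implicit Types (p q : 'rV[R]_2) (t : rhombus).

(** Colors are natural numbers here; only those below m.+1 are meaningful. *)
Definition vec (k : nat) : 'rV[R]_2 := xi (inord k).
Definition dy (k : nat) : R := ycoord (vec k).
Definition slope (k : nat) : R := xcoord (vec k) / dy k.
Definition pos (u : seq nat) : 'rV[R]_2 := \sum_(k <- u) vec k.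
Definition tile_of t : 'I_n * 'I_n * 'rV[R]_2 :=
  (inord t.1.2, inord t.2, pos t.1.1).

Lemma dy_gt0 k : 0 < dy k.
Proof. by have [y_gt0 _ _] := xi_adm; apply: y_gt0. Qed.

Lemma slope_mono i j : (i < j < n)%N -> slope i < slope j.
Proof.
case/andP=> ij jn; have [_ _ /(_ (inord i) (inord j))] := xi_adm.
rewrite !inordK //; last exact: ltn_trans jn.
move=> /(_ ij); rewrite -/(vec i) -/(vec j) -/(dy i) -/(dy j) => det_lt0.
rewrite /slope ltr_pdivrMr ?dy_gt0 // mulrAC ltr_pdivlMr ?dy_gt0 //.
by rewrite mulrC; lra.
Qed.

Lemma point_eq p q : xcoord p = xcoord q -> ycoord p = ycoord q -> p = q.
Proof.
move=> px py; apply/rowP => k; case: (unliftP ord0 k) => [l ->|-> //].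
by rewrite (_ : lift ord0 l = ord_max) //; apply/val_inj; rewrite /= (ord1 l).
Qed.

Lemma xcoordD p q : xcoord (p + q) = xcoord p + xcoord q.
Proof. by rewrite /xcoord mxE. Qed.
Lemma ycoordD p q : ycoord (p + q) = ycoord p + ycoord q.
Proof. by rewrite /ycoord mxE. Qed.
Lemma xcoordZ (a : R) p : xcoord (a *: p) = a * xcoord p.
Proof. by rewrite /xcoord mxE. Qed.
Lemma ycoordZ (a : R) p : ycoord (a *: p) = a * ycoord p.
Proof. by rewrite /ycoord mxE. Qed.
Lemma xcoord_sum (I : Type) (r : seq I) (F : I -> 'rV[R]_2) :
  xcoord (\sum_(k <- r) F k) = \sum_(k <- r) xcoord (F k).
Proof. by rewrite /xcoord summxE. Qed.
Lemma ycoord_sum (I : Type) (r : seq I) (F : I -> 'rV[R]_2) :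
  ycoord (\sum_(k <- r) F k) = \sum_(k <- r) ycoord (F k).
Proof. by rewrite /ycoord summxE. Qed.

Lemma xcoord_vec k : xcoord (vec k) = slope k * dy k.
Proof. by rewrite /slope divfK // gt_eqF ?dy_gt0. Qed.

Lemma xcoord_pos u : xcoord (pos u) = abscissa slope dy u.
Proof. by rewrite xcoord_sum; apply: eq_bigr => k _; rewrite xcoord_vec. Qed.

Lemma ycoord_pos u : ycoord (pos u) = height dy u.
Proof. exact: ycoord_sum. Qed.

Lemma pos_rcons u c : pos (rcons u c) = pos u + vec c.
Proof. by rewrite /pos -cats1 big_cat big_seq1. Qed.

Lemma pos_perm u v : perm_eq u v -> pos u = pos v.
Proof. by move=> uv; apply: perm_big. Qed.

Definition coordE :=
  (xcoordD, ycoordD, xcoordZ, ycoordZ, xcoord_vec, pos_rcons).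

Lemma tile_regionP t q : (t.1.2 < t.2 < n)%N ->
  tile_region xi (tile_of t) q <-> in_rhombus slope dy t (xcoord q) (ycoord q).
Proof.
case: t => [[u i] j] /= ij.
have d_gt0 : 0 < slope j - slope i by rewrite subr_gt0 slope_mono.
have yi := dy_gt0 i; have yj := dy_gt0 j.
rewrite /in_rhombus -xcoord_pos -ycoord_pos.
have -> : (ycoord (pos u) <= ycoord q <= ycoord (pos u) + (dy i + dy j)) =
          (0 <= ycoord q - ycoord (pos u) <= dy i + dy j).
  by rewrite subr_ge0 lerBlDl.
set h := ycoord q - ycoord (pos u); set x := xcoord q - xcoord (pos u).
split=> [[a [b [a01 b01 def_q]]]|/andP[h_t]].
  have hE : h = a * dy i + b * dy j.
    rewrite /h def_q -/(vec i) -/(vec j) !coordE -/(dy i) -/(dy j).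
    ring.
  have xE : x = a * (slope i * dy i) + b * (slope j * dy j).
    by rewrite /x def_q -/(vec i) -/(vec j) !coordE; ring.
  have h_t : 0 <= h <= dy i + dy j by rewrite hE; nra.
  rewrite h_t (bend_rhombus dy_gt0 slope_mono _ ij) //.
  have -> : x - slope i * h = b * ((slope j - slope i) * dy j).
    by rewrite hE xE; ring.
  have -> : slope j * h - x = a * ((slope j - slope i) * dy i).
    by rewrite hE xE; ring.
  have := mulr_gt0 d_gt0 yi; have := mulr_gt0 d_gt0 yj.
  by move=> *; apply/andP; split; nra.
rewrite (bend_rhombus dy_gt0 slope_mono _ ij) // => /andP[xi_b xj_a].
have di := mulr_gt0 d_gt0 yi; have dj := mulr_gt0 d_gt0 yj.
exists ((slope j * h - x) / ((slope j - slope i) * dy i)).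
exists ((x - slope i * h) / ((slope j - slope i) * dy j)).
split.
- by rewrite ler_pdivrMr // ler_pdivlMr // mul0r mul1r.
- by rewrite ler_pdivrMr // ler_pdivlMr // mul0r mul1r.
have [di0 dj0 dd0] : [/\ dy i != 0, dy j != 0 & slope j - slope i != 0].
  by rewrite !gt_eqF.
apply: point_eq; rewrite -/(vec i) -/(vec j) !coordE.
  have -> : xcoord q = xcoord (pos u) + x by rewrite /x; ring.
  by field; rewrite di0 dj0 dd0.
rewrite -/(dy i) -/(dy j).
have -> : ycoord q = ycoord (pos u) + h by rewrite /h; ring.
by field; rewrite di0 dj0 dd0.
Qed.

(** A linear function constant along the direction c: it tells on which side of
    an edge line of color c a point lies. *)
Definition side (c : nat) q : R := xcoord q - slope c * ycoord q.

Lemma sideD c p q : side c (p + q) = side c p + side c q.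
Proof. by rewrite /side !coordE; ring. Qed.

Lemma sideZ c a q : side c (a *: q) = a * side c q.
Proof. by rewrite /side !coordE; ring. Qed.

Lemma side_vec c k : side c (vec k) = (slope k - slope c) * dy k.
Proof. by rewrite /side xcoord_vec -/(dy k); ring. Qed.

Lemma left_edge_side t u c q : (t.1.2 < t.2 < n)%N -> (u, c) \in left_edges t ->
  tile_region xi (tile_of t) q -> side c (pos u) <= side c q.
Proof.
case: t => [[u0 i] j] /= ij; rewrite !inE => uc [a [b [a01 b01 ->]]].
have d_gt0 : 0 < slope j - slope i by rewrite subr_gt0 slope_mono.
have di := mulr_gt0 d_gt0 (dy_gt0 i); have dj := mulr_gt0 d_gt0 (dy_gt0 j).
by case/orP: uc => /eqP[-> ->];
  rewrite ?pos_rcons !(sideD, sideZ) -/(vec i) -/(vec j) !side_vec; nra.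
Qed.

Lemma right_edge_side t u c q : (t.1.2 < t.2 < n)%N ->
  (u, c) \in left_edges (mirror t) -> tile_region xi (tile_of t) q ->
  side c (pos u) <= side c q -> edge_region xi (pos u, inord c) q.
Proof.
case: t => [[u0 i] j] /= ij; rewrite !inE => uc [a [b [a01 b01 ->]]].
have d_gt0 : 0 < slope j - slope i by rewrite subr_gt0 slope_mono.
have di := mulr_gt0 d_gt0 (dy_gt0 i); have dj := mulr_gt0 d_gt0 (dy_gt0 j).
case/orP: uc => /eqP[-> ->];
  rewrite ?pos_rcons !(sideD, sideZ) -/(vec i) -/(vec j) !side_vec => q_u.
- exists b; split=> //=; have -> : a = 0 by nra.
  by rewrite scale0r addr0.
- exists a; split=> //=; have -> : b = 1 by nra.
  by rewrite scale1r addrAC.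
Qed.

Lemma edge_in_tile t u c q :
  (u, c) \in left_edges t \/ (u, c) \in left_edges (mirror t) ->
  edge_region xi (pos u, inord c) q -> tile_region xi (tile_of t) q.
Proof.
have z01 : 0 <= (0 : R) <= 1 by lra.
have o01 : 0 <= (1 : R) <= 1 by lra.
case: t => [[u0 i] j]; rewrite !inE => uc [a [a01 /= ->]].
case: uc => /orP[] /eqP[-> ->] /=; rewrite ?pos_rcons.
- by exists a, 0; split; rewrite // scale0r addr0.
- by exists 1, a; split; rewrite // scale1r.
- by exists 0, a; split; rewrite // scale0r addr0.
- by exists a, 1; split; rewrite // scale1r addrAC.
Qed.

Lemma tile_edgesE t u c :
  (u, c) \in left_edges t \/ (u, c) \in left_edges (mirror t) ->
  (pos u, inord c) \in tile_edges xi (tile_of t).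
Proof.
by case: t => [[u0 i] j]; rewrite !inE => -[] /orP[] /eqP[-> ->] /=;
  rewrite ?pos_rcons ?eqxx ?orbT.
Qed.

Lemma tile_verticesE t z :
  z \in left_vertices t \/ z \in left_vertices (mirror t) ->
  pos z \in tile_vertices xi (tile_of t).
Proof.
case: t => [[u0 i] j]; rewrite !inE => -[] /or3P[] /eqP-> /=;
  rewrite ?pos_rcons ?eqxx ?orbT //.
by rewrite (addrAC _ (vec j)) eqxx !orbT.
Qed.

Definition middle p q : 'rV[R]_2 := 2^-1 *: (p + q).

Lemma tile_region_middle t p q : tile_region xi (tile_of t) p ->
  tile_region xi (tile_of t) q -> tile_region xi (tile_of t) (middle p q).
Proof.
case: t => [[u i] j] [a [b [a01 b01 ->]]] [a' [b' [a01' b01' ->]]].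
exists ((a + a') / 2), ((b + b') / 2); split; [lra | lra |].
by apply: point_eq; rewrite !coordE; field.
Qed.

(** A corner of a rhombus is an extreme point. *)
Lemma vertex_extreme t z p q : (t.1.2 < t.2 < n)%N ->
  z \in left_vertices (mirror t) ->
  tile_region xi (tile_of t) p -> tile_region xi (tile_of t) q ->
  middle p q = pos z -> p = q.
Proof.
case: t => [[u i] j] /= ij z_t [a [b [a01 b01 ->]]].
case=> a' [b' [a01' b01' ->]] mid.
have d_gt0 : 0 < slope j - slope i by rewrite subr_gt0 slope_mono.
have di := mulr_gt0 d_gt0 (dy_gt0 i); have dj := mulr_gt0 d_gt0 (dy_gt0 j).
have Mi := congr1 (side i) mid; have Mj := congr1 (side j) mid.
suff [-> ->] : a = a' /\ b = b' by [].
have cancel_i (l l' : R) :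
    l * ((slope j - slope i) * dy i) = l' * ((slope j - slope i) * dy i) ->
    l = l'.
  by apply: mulIf; rewrite gt_eqF.
have cancel_j (l l' : R) :
    l * ((slope j - slope i) * dy j) = l' * ((slope j - slope i) * dy j) ->
    l = l'.
  by apply: mulIf; rewrite gt_eqF.
move: z_t Mi Mj; rewrite !inE /middle => /or3P[] /eqP->;
  rewrite ?pos_rcons !(sideD, sideZ) -/(vec i) -/(vec j) !side_vec => Mi Mj.
- have : a + a' = 0 by apply: cancel_i; lra.
  have : b + b' = 0 by apply: cancel_j; lra.
  by split; lra.
- have : a + a' = 0 by apply: cancel_i; lra.
  have : b + b' = 2 by apply: cancel_j; lra.
  by split; lra.
- have : a + a' = 2 by apply: cancel_i; lra.
  have : b + b' = 2 by apply: cancel_j; lra.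
  by split; lra.
Qed.

(** * A sweep yields a rhombus tiling *)

Section SweepTiling.
Variables (ts : seq rhombus).
Hypothesis ts_sweep : sweep n (iota 0 n) ts (rev (iota 0 n)).

Definition tiling : {fset 'I_n * 'I_n * 'rV[R]_2} :=
  seq_fset tt [seq tile_of t | t <- ts].

Lemma mem_tiling T : T \in tiling -> exists2 t, t \in ts & T = tile_of t.
Proof. by rewrite seq_fsetE => /mapP. Qed.

Lemma tile_in_tiling t : t \in ts -> tile_of t \in tiling.
Proof. by move=> t_ts; rewrite seq_fsetE map_f. Qed.

Lemma rhombus_lt t : t \in ts -> (t.1.2 < t.2 < n)%N.
Proof. by case: t => [[u i] j] /(sweep_rhombus ts_sweep)[]. Qed.

(** If the rhombi share an edge, they lie on opposite sides of its line, and
    their intersection is the face of either rhombus on this line. Otherwise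
    every common point is a vertex; the intersection is convex, and a vertex
    is extreme, so there is only one common point. *)
Lemma meet_ordered w t1 B t2 C w' : sweep n w (t1 :: B ++ t2 :: C) w' ->
  (t1.1.2 < t1.2 < n)%N -> (t2.1.2 < t2.2 < n)%N ->
  tile_region xi (tile_of t1) `&` tile_region xi (tile_of t2) !=set0 ->
  meet_properly xi (tile_of t1) (tile_of t2).
Proof.
move=> sw ij1 ij2 [q0 [q01 q02]].
have contact q :
  tile_region xi (tile_of t1) q -> tile_region xi (tile_of t2) q ->
  (exists u1 u2 c, [/\ (u1, c) \in left_edges (mirror t1),
                       (u2, c) \in left_edges t2 & perm_eq u1 u2]) \/
  (exists z1 z2, [/\ z1 \in left_vertices (mirror t1), z2 \in left_vertices t2,
                     perm_eq z1 z2 & q = pos z1]).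
- move=> /(tile_regionP _ ij1) q1 /(tile_regionP _ ij2) q2.
  case: (rhombi_contact dy_gt0 slope_mono sw q1 q2) => [|]; first by left.
  case=> z1 [z2 [z1t z2t z12 hE xE]].
  right; exists z1, z2; split=> //; apply: point_eq.
    by rewrite xE xcoord_pos.
  by rewrite hE ycoord_pos.
have [[u1 [u2 [c [u1_t u2_t u12]]]]|no_edge] := pselect (exists u1 u2 c,
    [/\ (u1, c) \in left_edges (mirror t1), (u2, c) \in left_edges t2 &
        perm_eq u1 u2]).
- right; exists (pos u1, inord c); split.
  + by apply: tile_edgesE; right.
  + by rewrite (pos_perm u12); apply: tile_edgesE; left.
  + apply/seteqP; split=> [q [q1 q2]|q q_e].
      apply: (right_edge_side ij1 u1_t q1).
      by rewrite (pos_perm u12); apply: left_edge_side u2_t q2.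
    split; first by apply: edge_in_tile q_e; right.
    by move: q_e; rewrite (pos_perm u12) => q_e; apply: edge_in_tile q_e; left.
left; exists q0.
case: (contact q0 q01 q02) => // -[z1 [z2 [z1_t z2_t z12 q0E]]].
split.
- by rewrite q0E; apply: tile_verticesE; right.
- by rewrite q0E (pos_perm z12); apply: tile_verticesE; left.
apply/seteqP; split=> [q [q1 q2]|_ -> //].
have [//|[z [z' [z_t _ _ mid]]]] := contact (middle q q0)
  (tile_region_middle q1 q01) (tile_region_middle q2 q02).
exact: vertex_extreme z_t q1 q01 mid.
Qed.

Lemma meet_properly_sym (T1 T2 : 'I_n * 'I_n * 'rV[R]_2) :
  meet_properly xi T1 T2 -> meet_properly xi T2 T1.
Proof.
by rewrite /meet_properly setIC => -[[z [? ? ?]]|[e [? ? ?]]];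
  [left; exists z | right; exists e].
Qed.

Lemma tiling_meet T1 T2 : T1 \in tiling -> T2 \in tiling -> T1 != T2 ->
  tile_region xi T1 `&` tile_region xi T2 !=set0 -> meet_properly xi T1 T2.
Proof.
move=> /mem_tiling[t1 t1_ts ->] /mem_tiling[t2 t2_ts ->] t12 meet.
have ij1 := rhombus_lt t1_ts; have ij2 := rhombus_lt t2_ts.
have t21 : t2 != t1 by apply: contraNneq t12 => ->.
move: t2_ts ts_sweep; case/path.splitPr: t1_ts => A B.
rewrite mem_cat inE (negPf t21).
case/orP=> /path.splitPr t2_AB; case: t2_AB => C D.
  rewrite -catA => /sweep_cat[w1 _ sw]; apply: meet_properly_sym.
  by apply: (meet_ordered sw) => //; rewrite setIC.
by case/sweep_cat=> w1 _ sw; apply: (meet_ordered sw).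
Qed.

Lemma sum_vec (a : nat -> R) :
  \sum_(k <- iota 0 n) a k *: vec k = \sum_(k < n) a k *: xi k.
Proof.
rewrite -[iota 0 n]/(index_iota 0 n) big_mkord.
by apply: eq_bigr => k _; rewrite /vec inord_val.
Qed.

Lemma tile_in_zonogon t :
  t \in ts -> tile_region xi (tile_of t) `<=` zonogon xi.
Proof.
case: t => [[u i] j] t_ts q [a [b [a01 b01 ->]]] /=.
have [_ [v w_uv]] := sweep_rhombus ts_sweep t_ts.
pose f k : R :=
  if k \in u then 1 else if k == i then a else if k == j then b else 0.
exists (fun k : 'I_n => f k); split.
  by move=> k; rewrite /f; do !case: ifP => _ //; lra.
rewrite -(sum_vec f) (perm_big _ w_uv) big_cat !big_cons /=.
have : uniq (u ++ i :: j :: v) by rewrite -(perm_uniq w_uv) iota_uniq.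
rewrite cat_uniq => /and3P[_ /hasPn not_u /=].
rewrite inE negb_or => /and3P[/andP[ij iv] jv _].
have iu : i \notin u by apply: not_u; rewrite mem_head.
have ju : j \notin u by apply: not_u; rewrite !inE eqxx orbT.
rewrite [X in _ = X + _](eq_big_seq vec) => [|k ku].
  2: by rewrite /f ku scale1r.
rewrite [X in _ = _ + (_ + (_ + X))]big1_seq => [|k /= kv].
  rewrite {1}/f (negPf iu) eqxx /f (negPf ju) eq_sym (negPf ij) eqxx.
  by rewrite addr0 addrA.
rewrite /f (negPf (not_u k _)) ?inE ?kv ?orbT //.
case: eqP kv iv => [->->//|_].
by case: eqP jv => [->|_ _]; rewrite ?scale0r // => /negPf->.
Qed.

Lemma zonogon_bounds q : zonogon xi q ->
  (path_at slope dy (iota 0 n) (ycoord q) <= xcoord q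
     <= path_at slope dy (rev (iota 0 n)) (ycoord q)) /\
  0 <= ycoord q <= height dy (iota 0 n).
Proof.
case=> a [a01 ->]; pose al k := a (inord k) * dy k.
have al_y k : 0 <= al k <= dy k.
  by rewrite /al; have := a01 (inord k); have := dy_gt0 k; nra.
have sumE : \sum_i a i *: xi i = \sum_(k <- iota 0 n) a (inord k) *: vec k.
  by rewrite sum_vec; apply: eq_bigr => k _; rewrite inord_val.
have -> : ycoord (\sum_i a i *: xi i) = \sum_(k <- iota 0 n) al k.
  by rewrite sumE ycoord_sum; apply: eq_bigr => k _; rewrite ycoordZ.
have -> : xcoord (\sum_i a i *: xi i) = \sum_(k <- iota 0 n) slope k * al k.
  rewrite sumE xcoord_sum; apply: eq_bigr => k _.
  by rewrite xcoordZ xcoord_vec /al; ring.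
have sorted_iota : pairwise (fun c d => slope c <= slope d) (iota 0 n).
  have : all (gtn n) (iota 0 n) by apply/allP => k; rewrite mem_iota.
  have : pairwise ltn (iota 0 n).
    by rewrite -sorted_pairwise ?iota_ltn_sorted //; apply: ltn_trans.
  elim: (iota 0 n) => //= c w IHw /andP[c_w /IHw{}IHw] /andP[_ w_n].
  rewrite IHw // andbT; apply/allP => d dw.
  by apply/ltW/slope_mono/andP; split; [apply: (allP c_w) | apply: (allP w_n)].
split; last first.
  rewrite sumr_ge0 /=; last by move=> k _; case/andP: (al_y k).
  by apply: ler_sum => k _; case/andP: (al_y k).
rewrite path_at_convex //=; last exact: dy_gt0.
have iota_rev : perm_eq (iota 0 n) (rev (iota 0 n)).
  by rewrite perm_sym perm_rev.
rewrite !(perm_big _ iota_rev) /=.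
apply: path_at_concave => //; first exact: dy_gt0.
rewrite -sorted_pairwise ?rev_sorted ?sorted_pairwise // => b a' c.
  exact: le_trans.
by move=> ? ?; apply: le_trans; eassumption.
Qed.

(** The edge of color c in the increasing word starts at the set of letters
    below c, and in the decreasing word at the set of letters above c. These
    sets differ unless c is the only letter. *)
Lemma edge_not_reversed k u c v u' v' : (1 < k)%N -> iota 0 k = u ++ c :: v ->
  perm_eq u' u -> rev (iota 0 k) = u' ++ c :: v' -> False.
Proof.
move=> k_gt1 def_k u'u def_rev.
have sz_u : size u = c.
  have := congr1 (fun w => nth 0%N w (size u)) def_k.
  rewrite nth_cat ltnn subnn nth_iota //.
  by have := congr1 size def_k; rewrite size_iota size_cat /=; lia.
have sz_u' := perm_size u'u.
have c_k : (c < k)%N.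
  by have := congr1 size def_k; rewrite size_iota size_cat /= sz_u; lia.
have def_u : u = iota 0 c.
  have := congr1 (take c) def_k; rewrite take_iota take_cat sz_u ltnn subnn.
  by rewrite take0 cats0 (minn_idPl (ltnW c_k)).
have def_u' : u' = rev (iota (k - c) c).
  have := congr1 (take c) def_rev.
  rewrite take_rev size_iota drop_iota take_cat sz_u' sz_u ltnn subnn take0.
  rewrite cats0 => <-.
  by congr (rev (iota _ _)); lia.
case: c => [|c] in sz_u c_k def_k def_rev def_u def_u' *.
  have := congr1 (fun w => nth 0%N w 0) def_rev.
  by rewrite def_u' /= nth_rev ?size_iota 1?ltnW // nth_iota; lia.
have : 0%N \in u' by rewrite (perm_mem u'u) def_u mem_head.
by rewrite def_u' mem_rev mem_iota; lia.
Qed.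

(** Points of the left boundary are not to the right of the first path. Each of
    its edges is a left edge of a rhombus, because it is absent from the last
    path. *)
Lemma tiling_cover : (0 < m)%N ->
  zonogon xi `<=` \bigcup_(T in [set T | T \in tiling]) tile_region xi T.
Proof.
move=> m_gt0 q /zonogon_bounds[/andP[xl xr] hq].
suff [t t_ts q_t] : exists2 t, t \in ts &
    in_rhombus slope dy t (xcoord q) (ycoord q).
  exists (tile_of t); first exact: tile_in_tiling.
  by apply/tile_regionP => //; apply: rhombus_lt.
have [lt_x|le_x] := ltrP (path_at slope dy (iota 0 n) (ycoord q)) (xcoord q).
  by apply: (sweep_cover dy_gt0 ts_sweep); rewrite lt_x.
have [u [c [v [def_w h_c]]]] := edge_at hq isT.
have [[t [u' [t_ts u'u c_t]]]|[u' [v' [u'u def_w']]]] :=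
  sweep_edge ts_sweep def_w; last first.
  by have := @edge_not_reversed n u c v u' v' m_gt0 def_w u'u def_w'.
exists t => //.
have := left_edge_in_rhombus dy_gt0 slope_mono (rhombus_lt t_ts) c_t
  (h := ycoord q).
have hE := height_perm dy u'u; have xE := abscissa_perm slope dy u'u.
rewrite hE => /(_ h_c); congr (in_rhombus _ _ _ _ _).
move: xl le_x; rewrite def_w path_at_edge // ?xE /abscissa; first lra.
exact: dy_gt0.
Qed.

Theorem sweep_is_tiling : (0 < m)%N -> is_tiling xi tiling.
Proof.
move=> m_gt0; split=> [T /mem_tiling[t /rhombus_lt/andP[ij jn] ->]||].
- by rewrite /= !inordK // (ltn_trans ij).
- apply/seteqP; split; last exact: tiling_cover.
  by move=> q [T /mem_tiling[t t_ts ->]]; apply: tile_in_zonogon.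
- exact: tiling_meet.
Qed.

Lemma snake_of_word (s : linord n) :
  (forall u c v, nword s = u ++ c :: v -> on_left_edge ts u c) ->
  s \in Sigma xi tiling.
Proof.
move=> edges; rewrite inE; apply/asboolP.
have word_edges u (v : seq 'I_n) : nword s = u ++ map val v ->
    exists2 e : seq ('rV[R]_2 * 'I_n),
      is_dipath xi tiling (pos u) e (pos (nword s)) &
      map (@edge_color R n) e = v.
  elim: v u => [|c v IHv] u def_s.
    by exists [::]; rewrite //= def_s cats0.
  have [|e e_path e_v] := IHv (rcons u c); first by rewrite cat_rcons.
  exists ((pos u, c) :: e); last by rewrite /= e_v.
  split=> //; last by move: e_path; rewrite pos_rcons /vec inord_val.
  have [t [u' [t_ts u'u c_t]]] := edges _ _ _ def_s.
  exists (tile_of t); first exact: tile_in_tiling.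
  by rewrite -(pos_perm u'u) -[c]inord_val; apply: tile_edgesE; left.
have [|e e_path e_s] := word_edges [::] (word s); first by [].
have top : pos (nword s) = top_vertex xi.
  rewrite /pos /nword big_map /top_vertex.
  under eq_bigr do rewrite /vec inord_val.
  rewrite big_uniq /=; last by case: s {edges word_edges e_s e_path}.
  by apply: eq_bigl => i; rewrite -(mem_map val_inj) mem_nword.
have bottom : pos [::] = 0 by apply: big_nil.
by exists e; rewrite // /is_snake /bottom_vertex -bottom -top.
Qed.

(** A word accepted by the automaton is the word of a linear order, and this
    order is a snake, since each of its letters follows a left edge. *)
Lemma left_snakes_le : (N.to_nat (left_snakes n ts) <= #|Sigma xi tiling|)%N.
Proof.
rewrite /left_snakes -size_words cardE -(size_map (@nword n)).
apply: uniq_leq_size => [|w].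
  by apply: uniq_words => b; apply: undup_uniq.
rewrite mem_words => /andP[/eqP sz_w].
rewrite (_ : nseq n false = indicator n [::]); last first.
  by rewrite -(@foldl_set_bit n [::]).
case/(legal_left_snake ts_sweep) => //; rewrite /= => w_uniq w_n edges.
have sz : size [seq inord k : 'I_n | k <- w] == n by rewrite size_map sz_w.
have val_w : map val [seq inord k : 'I_n | k <- w] = w.
  rewrite -map_comp -[RHS]map_id; apply/eq_in_map => k kw /=.
  by rewrite inordK // (allP w_n).
have w_uniq' : uniq (Tuple sz) by rewrite -(map_inj_uniq val_inj) /= val_w.
apply/mapP; exists (LinOrd w_uniq'); last by rewrite /nword /= val_w.
rewrite mem_enum; apply: snake_of_word => u c v.
by rewrite /nword /= val_w => /edges.
Qed.

End SweepTiling.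
End Tiling.

(** * Comparison of the two counts *)

Theorem mainTheorem5 (R : realType) (xi : 'I_42 -> 'rV[R]_2)
    (xi_adm : admissible xi) :
  (Phi 42 < gamma xi)%N.
Proof.
apply/ltn_gammaP; exists (tiling xi (rhombi 21)).
  exact: (sweep_is_tiling xi_adm rhombi_sweep).
apply: leq_ltn_trans (Phi_le 42) _.
apply: leq_trans (left_snakes_le xi rhombi_sweep).
by apply: ltn_to_nat; vm_compute.
Qed.
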